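(* Let $\emptyset\neq\mathcal{Y}\subseteq\mathbb{R}^n$, let $\mathbf{\Psi}:\mathcal{Y}\to I(\mathbb{R})$ be an interval-valued function and let $u\in\mathcal{Y}$. If the $gH$-weak subdifferential $\partial^w\mathbf{\Psi}(u)$ is nonempty, then $\partial^w\mathbf{\Psi}(u)$ is closed.
   Context: $I(\mathbb{R})$ is the set of compact intervals $\mathbf{X}=[\underline{x},\overline{x}]$, $\underline{x}\le\overline{x}$; a real number $c$ is identified with $[c,c]$. Operations: $\mathbf{X}\oplus\mathbf{Y}=[\underline{x}+\underline{y},\overline{x}+\overline{y}]$; $\lambda\odot\mathbf{X}=[\min\{\lambda\underline{x},\lambda\overline{x}\},\max\{\lambda\underline{x},\lambda\overline{x}\}]$ for $\lambda\in\mathbb{R}$; $gH$-difference $\mathbf{X}\ominus_{gH}\mathbf{Y}=[\min\{\underline{x}-\underline{y},\overline{x}-\overline{y}\},\max\{\underline{x}-\underline{y},\overline{x}-\overline{y}\}]$. Order: $\mathbf{X}\preceq\mathbf{Y}$ iff $\underline{x}\le\underline{y}$ and $\overline{x}\le\overline{y}$. For $\widehat{\mathbf{G}}=(\mathbf{G}_1,\dots,\mathbf{G}_n)\in I(\mathbb{R})^n$ and $d\in\mathbb{R}^n$, $\widehat{\mathbf{G}}^\top\odot d=\bigoplus_{i=1}^n d_i\odot\mathbf{G}_i$. $\mathbb{R}_+=[0,\infty)$ and $\|\cdot\|$ is the Euclidean norm. The $gH$-weak subdifferential of $\mathbf{\Psi}$ at $u\in\mathcal{Y}$ is $$\partial^w\mathbf{\Psi}(u)=\{(\widehat{\mathbf{G}},c)\in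 I(\mathbb{R})^n\times\mathbb{R}_+:\ \widehat{\mathbf{G}}^\top\odot(y-u)\ominus_{gH}c\|y-u\|\preceq\mathbf{\Psi}(y)\ominus_{gH}\mathbf{\Psi}(u)\ \ \forall y\in\mathcal{Y}\}.$$ Norms: $\|\mathbf{X}\|_{I(\mathbb{R})}=\max\{|\underline{x}|,|\overline{x}|\}$ and $\|\widehat{\mathbf{X}}\|_{I(\mathbb{R})^n}=\sum_{j=1}^n\|\mathbf{X}_j\|_{I(\mathbb{R})}$. A sequence $\widehat{\mathbf{M}}_k$ in $I(\mathbb{R})^n$ converges to $\widehat{\mathbf{M}}$ if $\|\widehat{\mathbf{M}}_k\ominus_{gH}\widehat{\mathbf{M}}\|_{I(\mathbb{R})^n}\to0$ ($\ominus_{gH}$ componentwise). A subset of $I(\mathbb{R})^n\times\mathbb{R}_+$ is closed if it contains the limit of each of its sequences $(\widehat{\mathbf{M}}_k,c_k)$ that converges in $I(\mathbb{R})^n\times\mathbb{R}_+$ (convergence in each factor). *)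

(* Defs.v *)
From HB Require Import structures.
From mathcomp Require Import all_boot all_order all_algebra.
From mathcomp Require Import all_classical all_reals all_analysis.
Set Implicit Arguments.
Unset Strict Implicit.
Unset Printing Implicit Defensive.
Import Order.TTheory GRing.Theory Num.Theory.
Import numFieldNormedType.Exports.
Local Open Scope classical_set_scope.
Local Open Scope ring_scope.

Record cint (R : realType) := CInt { lo : R ; hi : R ; lo_le_hi : lo <= hi }.

Lemma min_le_max (R : realType) (a b : R) : Num.min a b <= Num.max a b.
Proof. by rewrite ge_min le_max lexx. Qed.

Definition cint_cst (R : realType) (c : R) : cint R := CInt (lexx c).

Definition cint_add (R : realType) (X Y : cint R) : cint R :=
  CInt (lerD (lo_le_hi X) (lo_le_hi Y)).

Definition cint_scale (R : realType) (a : R) (X : cint R) : cint R :=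
  CInt (min_le_max (a * lo X) (a * hi X)).

Definition gHsub (R : realType) (X Y : cint R) : cint R :=
  CInt (min_le_max (lo X - lo Y) (hi X - hi Y)).

Definition cint_le (R : realType) (X Y : cint R) : bool :=
  (lo X <= lo Y) && (hi X <= hi Y).

Definition cint_dot (R : realType) (n : nat) (G : 'rV[cint R]_n) (d : 'rV[R]_n)
  : cint R :=
  \big[@cint_add R/cint_cst 0]_(i < n) cint_scale (d 0 i) (G 0 i).

(* The canonical norm `|x| on 'rV[R]_n is the sup norm, hence this definition. *)
Definition enorm (R : realType) (n : nat) (x : 'rV[R]_n) : R :=
  Num.sqrt (\sum_(i < n) x 0 i ^+ 2).

Definition cint_norm (R : realType) (X : cint R) : R :=
  Num.max `|lo X| `|hi X|.

Definition cintv_norm (R : realType) (n : nat) (X : 'rV[cint R]_n) : R :=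
  \sum_(j < n) cint_norm (X 0 j).

Definition gHsubv (R : realType) (n : nat) (X Y : 'rV[cint R]_n)
  : 'rV[cint R]_n :=
  \row_j gHsub (X 0 j) (Y 0 j).

Definition cintv_cvg (R : realType) (n : nat) (M : nat -> 'rV[cint R]_n)
  (L : 'rV[cint R]_n) : Prop :=
  cintv_norm (gHsubv (M k) L) @[k --> \oo] --> (0 : R).

(* Psi is only defined on Y: the set Y is used here as the type of its
   elements, and \val is the inclusion of Y into R^n. *)
Definition gH_weak_subdiff (R : realType) (n : nat) (Y : set 'rV[R]_n)
  (Psi : Y -> cint R) (u : Y) : set ('rV[cint R]_n * {nonneg R}) :=
  [set Gc | forall y : Y,
     cint_le (gHsub (cint_dot Gc.1 (\val y - \val u))
                    (cint_cst (Gc.2%:num * enorm (\val y - \val u))))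
             (gHsub (Psi y) (Psi u))].

Definition seq_closed (R : realType) (n : nat)
  (S : set ('rV[cint R]_n * {nonneg R})) : Prop :=
  forall (s : nat -> 'rV[cint R]_n * {nonneg R})
         (M : 'rV[cint R]_n) (c : {nonneg R}),
    (forall k, S (s k)) ->
    cintv_cvg (fun k => (s k).1) M ->
    (s k).2%:num @[k --> \oo] --> c%:num ->
    S (M, c).

(* Main.v *)
(** Convergence of interval vectors forces convergence of all endpoints, and
    the two endpoints of [cint_dot G d] and of a gH-difference are built from
    the endpoints of their arguments by sums, products and min/max.  Hence both
    sides of the inequality defining the subdifferential depend continuously on
    [(G, c)], and non-strict inequalities pass to the limit. *)
Require Import Defs.
From mathcomp Require Import all_boot all_order all_algebra.
From mathcomp Require Import all_classical all_reals all_analysis.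
Set Implicit Arguments.
Unset Strict Implicit.
Import Order.TTheory GRing.Theory Num.Theory.
Import numFieldNormedType.Exports.
Local Open Scope classical_set_scope.
Local Open Scope ring_scope.

(** The formula [(a + b - |a - b|) / 2] for the minimum reduces the claim to limits of sums,
    products and absolute values; the maximum is handled alike, with a plus sign. *)
Lemma cvg_minr (R : realType) (f g : nat -> R) (a b : R) :
  f k @[k --> \oo] --> a -> g k @[k --> \oo] --> b ->
  Num.min (f k) (g k) @[k --> \oo] --> Num.min a b.
Proof.
move=> fa gb; rewrite minr_absE; under eq_fun do rewrite minr_absE.
by apply: cvgM; [apply: cvgB; [exact: cvgD|apply: cvg_norm; exact: cvgB]
                |exact: cvg_cst].
Qed.

Lemma cvg_maxr (R : realType) (f g : nat -> R) (a b : R) :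
  f k @[k --> \oo] --> a -> g k @[k --> \oo] --> b ->
  Num.max (f k) (g k) @[k --> \oo] --> Num.max a b.
Proof.
move=> fa gb; rewrite maxr_absE; under eq_fun do rewrite maxr_absE.
by apply: cvgM; [apply: cvgD; [exact: cvgD|apply: cvg_norm; exact: cvgB]
                |exact: cvg_cst].
Qed.

(** Endpointwise form of convergence, chosen because it passes through each interval operation
    separately. *)
Definition cint_cvg (R : realType) (X : nat -> cint R) (L : cint R) : Prop :=
  lo (X k) @[k --> \oo] --> lo L /\ hi (X k) @[k --> \oo] --> hi L.

(** The gH-difference only sorts the two endpoint differences, and the maximum of their absolute
    values ignores the order. *)
Lemma cint_norm_gHsub (R : realType) (X Y : cint R) :
  cint_norm (gHsub X Y) = Num.max `|lo X - lo Y| `|hi X - hi Y|.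
Proof.
rewrite /cint_norm /=.
by case: (leP (lo X - lo Y) (hi X - hi Y)) => //; rewrite maxC.
Qed.

Lemma cint_norm_ge0 (R : realType) (X : cint R) : 0 <= cint_norm X.
Proof. by rewrite le_max normr_ge0. Qed.

(** Each summand of [cintv_norm] is at most the whole sum, since all of them are nonnegative. *)
Lemma cintv_cvg_coord (R : realType) (n : nat) (M : nat -> 'rV[cint R]_n)
    (L : 'rV[cint R]_n) (i : 'I_n) :
  cintv_cvg M L -> cint_cvg (fun k => M k 0 i) (L 0 i).
Proof.
move=> ML.
have dist_le k : Num.max `|lo (M k 0 i) - lo (L 0 i)|
    `|hi (M k 0 i) - hi (L 0 i)| <= cintv_norm (gHsubv (M k) L).
  rewrite -cint_norm_gHsub /cintv_norm (bigD1 i)//= mxE lerDl.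
  by apply: sumr_ge0 => j _; exact: cint_norm_ge0.
(* Here [e] stands for [lo] or [hi]; the distance is squeezed between 0 and a norm tending to 0. *)
have endpoint (e : cint R -> R) :
    (forall k, `|e (M k 0 i) - e (L 0 i)| <= cintv_norm (gHsubv (M k) L)) ->
    e (M k 0 i) @[k --> \oo] --> e (L 0 i).
  move=> e_le; apply/subr_cvg0/norm_cvg0P.
  apply: (squeeze_cvgr _ (cvg_cst 0) ML).
  by apply: nearW => k; rewrite normr_ge0 e_le.
by split; apply: endpoint => k; apply: le_trans (dist_le k);
  rewrite le_max lexx ?orbT.
Qed.

Lemma cint_cvg_cst (R : realType) (c : nat -> R) (l : R) :
  c k @[k --> \oo] --> l ->
  cint_cvg (fun k => cint_cst (c k)) (cint_cst l).
Proof. by []. Qed.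

Lemma cint_cvg_add (R : realType) (X Y : nat -> cint R) (K L : cint R) :
  cint_cvg X K -> cint_cvg Y L ->
  cint_cvg (fun k => cint_add (X k) (Y k)) (cint_add K L).
Proof. by move=> [Xlo Xhi] [Ylo Yhi]; split; exact: cvgD. Qed.

Lemma cint_cvg_scale (R : realType) (a : R) (X : nat -> cint R) (L : cint R) :
  cint_cvg X L ->
  cint_cvg (fun k => cint_scale a (X k)) (cint_scale a L).
Proof.
by move=> [Xlo Xhi]; split; [apply: cvg_minr|apply: cvg_maxr];
  apply: cvgM => //; exact: cvg_cst.
Qed.

Lemma cint_cvg_gHsub (R : realType) (X Y : nat -> cint R) (K L : cint R) :
  cint_cvg X K -> cint_cvg Y L ->
  cint_cvg (fun k => gHsub (X k) (Y k)) (gHsub K L).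
Proof.
by move=> [Xlo Xhi] [Ylo Yhi]; split; [apply: cvg_minr|apply: cvg_maxr];
  exact: cvgB.
Qed.

Lemma cint_cvg_dot (R : realType) (n : nat) (M : nat -> 'rV[cint R]_n)
    (L : 'rV[cint R]_n) (d : 'rV[R]_n) :
  cintv_cvg M L ->
  cint_cvg (fun k => cint_dot (M k) d) (cint_dot L d).
Proof.
move=> ML; rewrite /cint_dot.
(* Induction on the list of indices: continuity of the binary [cint_add] then suffices. *)
elim: (index_enum _) => [|i r IHr].
  rewrite big_nil.
  under [X in cint_cvg X]eq_fun do rewrite big_nil.
  by apply: cint_cvg_cst; exact: cvg_cst.
rewrite big_cons.
under [X in cint_cvg X]eq_fun do rewrite big_cons.
by apply: cint_cvg_add => //; apply: cint_cvg_scale; exact: cintv_cvg_coord.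
Qed.

Lemma cint_cvg_le (R : realType) (X : nat -> cint R) (L B : cint R) :
  cint_cvg X L -> (forall k, cint_le (X k) B) -> cint_le L B.
Proof.
move=> [Xlo Xhi] XB; apply/andP; split.
  by apply: (cvgr_to_le Xlo); apply: nearW => k; case/andP: (XB k).
by apply: (cvgr_to_le Xhi); apply: nearW => k; case/andP: (XB k).
Qed.

Theorem theorem2 (R : realType) (n : nat) (Y : set 'rV[R]_n)
  (Y_neq0 : Y !=set0) (Psi : Y -> cint R) (u : Y) :
  gH_weak_subdiff Psi u !=set0 -> seq_closed (gH_weak_subdiff Psi u).
Proof.
move=> _ s M c sS sM sc y /=.
(* With [y] fixed, only the left side varies with [k], so the limit is taken for each [y] separately
   against a constant bound. *)
apply: (@cint_cvg_le _ (fun k => gHsub (cint_dot (s k).1 (\val y - \val u))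
    (cint_cst ((s k).2%:num * enorm (\val y - \val u))))); last first.
  by move=> k; exact: sS.
apply: cint_cvg_gHsub; first exact: cint_cvg_dot.
by apply: cint_cvg_cst; apply: cvgM => //; exact: cvg_cst.
Qed.
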